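(* Let $A$ be a $t$-locally GCD domain (i.e. an integral domain such that $A_{\mathfrak m}$ is a GCD domain for every $\mathfrak m\in t\text{-}\mathrm{Max}(A)$). If every nonzero $t$-locally principal ideal of $A$ is $t$-invertible, then $A$ has the $t$-finite character.
   Context: Let $A$ be an integral domain with quotient field $K$. ''Ideal'' means integral ideal. For a nonzero fractional ideal $I$, $I^{-1}=(A:I)=\{x\in K: xI\subseteq A\}$, $I^v=(I^{-1})^{-1}$, and $I^t=\bigcup\{J^v: J\subseteq I,\ J \text{ nonzero finitely generated}\}$. $I$ is a $t$-ideal if $I^t=I$, and $I$ is $t$-invertible if $(II^{-1})^t=A$. $t\text{-}\mathrm{Max}(A)$ is the set of $t$-maximal ideals, i.e. the maximal elements of the set of proper (nonzero, integral) $t$-ideals; they are prime. $A$ has the $t$-finite character if each nonzero element of $A$ is contained in only finitely many $t$-maximal ideals. An ideal $I$ is $t$-locally principal if $IA_{\mathfrak m}$ is a principal ideal of $A_{\mathfrak m}$ for every $\mathfrak m\in t\text{-}\mathrm{Max}(A)$. *)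

(* Defs.v *)
From HB Require Import structures.
From mathcomp Require Import all_boot all_algebra all_classical.

Set Implicit Arguments.
Unset Strict Implicit.
Unset Printing Implicit Defensive.

Import GRing.Theory.

Local Open Scope classical_set_scope.
Local Open Scope ring_scope.

(* Fractional and integral ideals of the integral domain A, as well as the     *)
(* localizations of A, are all represented as subsets of K = {fraction A}.     *)

Local Notation "x %:F" := (@FracField.tofrac _ x).

Definition integers (A : idomainType) : set {fraction A} :=
  range (@FracField.tofrac A).
Arguments integers A : clear implicits.

Definition submodule (A : idomainType) (I : set {fraction A}) : Prop :=
  [/\ I 0,
      (forall x y, I x -> I y -> I (x + y))
    & (forall (a : A) x, I x -> I (a%:F * x))].

Definition integral_ideal (A : idomainType) (I : set {fraction A}) : Prop :=
  submodule I /\ I `<=` integers A.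

Definition nonzero (A : idomainType) (I : set {fraction A}) : Prop :=
  exists2 x, I x & x != 0.

Definition span (A : idomainType) (s : seq {fraction A}) : set {fraction A} :=
  [set x | exists c : nat -> A, x = \sum_(i < size s) (c i)%:F * s`_i].

Definition finitely_generated (A : idomainType) (I : set {fraction A}) : Prop :=
  exists s : seq {fraction A}, I = span s.

(* Finite sums of products; also used to extend an ideal I to I A_m. *)
Definition ideal_mul (A : idomainType) (I J : set {fraction A}) :
    set {fraction A} :=
  [set z | exists (n : nat) (x y : 'I_n -> {fraction A}),
     [/\ forall i, I (x i), forall i, J (y i) & z = \sum_(i < n) x i * y i]].

Definition ideal_inv (A : idomainType) (I : set {fraction A}) :
    set {fraction A} :=
  [set x | forall y, I y -> integers A (x * y)].

Definition v_closure (A : idomainType) (I : set {fraction A}) :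
    set {fraction A} :=
  ideal_inv (ideal_inv I).

Definition t_closure (A : idomainType) (I : set {fraction A}) :
    set {fraction A} :=
  \bigcup_(J in [set J | [/\ J `<=` I, nonzero J & finitely_generated J]])
    v_closure J.

Definition t_ideal (A : idomainType) (I : set {fraction A}) : Prop :=
  t_closure I = I.

Definition t_invertible (A : idomainType) (I : set {fraction A}) : Prop :=
  t_closure (ideal_mul I (ideal_inv I)) = integers A.

Definition proper_t_ideal (A : idomainType) (I : set {fraction A}) : Prop :=
  [/\ integral_ideal I, nonzero I, t_ideal I & I <> integers A].

Definition t_Max (A : idomainType) : set (set {fraction A}) :=
  [set M | proper_t_ideal M /\
     forall N, proper_t_ideal N -> M `<=` N -> N = M].
Arguments t_Max A : clear implicits.

(* Denominators are nonzero as soon as 0 lies in M, and this is a subring of K *)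
(* when M is prime.                                                            *)
Definition localization (A : idomainType) (M : set {fraction A}) :
    set {fraction A} :=
  [set x | exists a s : A, ~ M s%:F /\ x = a%:F / s%:F].

Definition dvd_in (A : idomainType) (B : set {fraction A})
    (x y : {fraction A}) : Prop :=
  exists2 z, B z & y = x * z.

(* For a subring B of K. *)
Definition GCD_domain (A : idomainType) (B : set {fraction A}) : Prop :=
  forall x y, B x -> B y -> x != 0 -> y != 0 ->
  exists d, [/\ B d, dvd_in B d x, dvd_in B d y
    & forall e, B e -> dvd_in B e x -> dvd_in B e y -> dvd_in B e d].

Definition t_locally_GCD (A : idomainType) : Prop :=
  forall M, t_Max A M -> GCD_domain (localization M).

Definition principal_in (A : idomainType) (B I : set {fraction A}) : Prop :=
  exists2 g, B g & I = [set g * b | b in B].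

Definition t_locally_principal (A : idomainType) (I : set {fraction A}) :
    Prop :=
  forall M, t_Max A M ->
    principal_in (localization M) (ideal_mul I (localization M)).

Definition t_finite_character (A : idomainType) : Prop :=
  forall a : A, a != 0 -> finite_set [set M | t_Max A M /\ M a%:F].

(* Main.v *)
(** Suppose some a <> 0 lies in infinitely many t-maximal ideals. Since distinct
    t-maximal ideals are t-comaximal, one can choose inductively finitely
    generated proper ideals Q_0, Q_1, ... containing a such that no t-maximal
    ideal contains two of them: given the product P_n of the first n, take two
    t-maximal ideals M1, M2 above a but not above P_n, and finitely generated
    Q' in M1, Q'' in M2 sharing no t-maximal ideal with each other or with P_n.
    As no t-maximal ideal contains both, one of them leaves infinitely many
    t-maximal ideals above a uncovered, and it can serve as Q_n.

    Let J_n = (aA : P_n) and let I be the union of the increasing chain J_n.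
    Locally at M at most one Q_k is proper, so the chain becomes stationary,
    and (aA_M : P_n A_M) is generated by a / gcd(P_n). Hence I is t-locally
    principal, so t-invertible. Since only finitely many elements of I enter
    into 1 \in (I I^-1)^t, this forces J_n = J_(n+1) for some n. As P_n and Q_n
    are t-comaximal, it follows that Q_n^-1 = A, which is impossible because Q_n
    lies in a t-maximal ideal. *)

Require Import Defs.
From HB Require Import structures.
From mathcomp Require Import all_boot all_algebra all_classical.

Set Implicit Arguments.
Unset Strict Implicit.
Unset Printing Implicit Defensive.

Import GRing.Theory.

Local Open Scope classical_set_scope.
Local Open Scope quotient_scope.
Local Open Scope ring_scope.

Local Notation "x %:F" := (@FracField.tofrac _ x).
(* all_algebra shadows span by the span of vector.v. *)
Local Notation span := Defs.span.

Lemma fractionP (A : idomainType) (x : {fraction A}) :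
  exists a s : A, s != 0 /\ x = a%:F / s%:F.
Proof.
elim/quotW: x => r.
exists r.1, r.2; split; first exact: denom_ratioP.
have d0 : (r.2)%:F != 0 :> {fraction A} by rewrite tofrac_eq0 denom_ratioP.
apply: (mulIf d0); rewrite divfK //.
rewrite !piE; apply/eqmodP; rewrite /= FracField.equivfE /FracField.mulf.
by rewrite !numden_Ratio ?mulf_neq0 ?oner_eq0 ?denom_ratioP // !mulr1 mulrC.
Qed.

(** * The v- and t-closures *)

Section Closures.
Variable A : idomainType.
Implicit Types (I J : set {fraction A}) (s t : seq {fraction A}).

Lemma integers_tofrac (a : A) : integers A a%:F.
Proof. by exists a. Qed.

Lemma integers0 : integers A 0.
Proof. by exists 0; rewrite ?tofrac0. Qed.

Lemma integers1 : integers A 1.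
Proof. by exists 1; rewrite ?tofrac1. Qed.

Lemma integersD x y : integers A x -> integers A y -> integers A (x + y).
Proof. by move=> [a _ <-] [b _ <-]; exists (a + b); rewrite ?tofracD. Qed.

Lemma integersM x y : integers A x -> integers A y -> integers A (x * y).
Proof. by move=> [a _ <-] [b _ <-]; exists (a * b); rewrite ?tofracM. Qed.

Lemma submodule_sum I n (f : 'I_n -> {fraction A}) :
  submodule I -> (forall i, I (f i)) -> I (\sum_(i < n) f i).
Proof. by move=> [I0 ID _] If; elim/big_ind: _. Qed.

Lemma submodule_integers : submodule (integers A).
Proof.
split; [exact: integers0|exact: integersD|].
by move=> a x; apply: integersM; exact: integers_tofrac.
Qed.

Lemma submodule_inv I : submodule (ideal_inv I).
Proof.
split=> [y _|x y hx hy z Iz|a x hx z Iz]; first by rewrite mul0r; exact: integers0.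
  by rewrite mulrDl; apply: integersD; [exact: hx|exact: hy].
by rewrite -mulrA; apply: integersM; [exact: integers_tofrac|exact: hx].
Qed.

Lemma ideal_invS I J : I `<=` J -> ideal_inv J `<=` ideal_inv I.
Proof. by move=> IJ y hy x /IJ; exact: hy. Qed.

Lemma v_closureS I J : I `<=` J -> v_closure I `<=` v_closure J.
Proof. by move=> IJ; do 2!apply: ideal_invS. Qed.

Lemma sub_v_closure I : I `<=` v_closure I.
Proof. by move=> x Ix y hy; rewrite mulrC; exact: hy. Qed.

Lemma v_closure_sub I J : I `<=` v_closure J -> v_closure I `<=` v_closure J.
Proof.
by move=> IJ; apply: ideal_invS => y hy x /IJ; rewrite mulrC; exact.
Qed.

Lemma mem_span s x : x \in s -> span s x.
Proof.
move=> xs; exists (fun i => (i == index x s)%:R).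
rewrite -index_mem in xs; rewrite (bigD1 (Ordinal xs)) //= eqxx tofrac1 mul1r.
rewrite nth_index -?index_mem // big1 ?addr0 // => i.
by rewrite -val_eqE /= => /negPf ->; rewrite tofrac0 mul0r.
Qed.

Lemma ideal_inv_span s : ideal_inv (span s) = ideal_inv [set` s].
Proof.
rewrite eqEsubset; split=> y hy x /=; last first.
  move=> [c ->]; rewrite mulr_sumr; apply: submodule_sum => [|i].
    exact: submodule_integers.
  rewrite mulrCA; apply: integersM; first exact: integers_tofrac.
  by apply: hy; rewrite /= mem_nth.
by move=> xs; apply: hy; exact: mem_span.
Qed.

Lemma t_closure_seq I y : t_closure I y ->
  exists s, [/\ [set` s] `<=` I, nonzero [set` s] & v_closure [set` s] y].
Proof.
move=> [J [JI [z Jz z0] [s Js]] vy]; subst J; exists s; split.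
- by move=> x xs; apply: JI; exact: mem_span.
- apply: contrapT => h; case: Jz => c zE; move: z0.
  rewrite zE big1 ?eqxx // => i _.
  have [->|s0] := eqVneq (s`_i) 0; first by rewrite mulr0.
  by case: h; exists s`_i; rewrite //= mem_nth.
- by rewrite /v_closure -ideal_inv_span.
Qed.

Lemma t_closureP I y : submodule I ->
  t_closure I y <->
  exists s, [/\ [set` s] `<=` I, nonzero [set` s] & v_closure [set` s] y].
Proof.
move=> Imod; split=> [|[s [sI [z sz z0] vy]]]; first exact: t_closure_seq.
exists (span s); last by rewrite /v_closure ideal_inv_span.
split; last by exists s.
  move=> _ [c ->]; apply: submodule_sum => // i.
  by case: Imod => _ _; apply; apply: sI; rewrite /= mem_nth.
by exists z => //; exact: mem_span.
Qed.

Lemma sub_t_closure I : submodule I -> nonzero I -> I `<=` t_closure I.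
Proof.
move=> Im [z Iz z0] x Ix; apply/t_closureP => //; exists [:: z; x]; split.
- by move=> y /=; rewrite !inE => /orP[] /eqP ->.
- by exists z; rewrite //= mem_head.
- by apply: sub_v_closure; rewrite /= !inE eqxx orbT.
Qed.

(** The union defining the t-closure is directed: concatenating the sequences that witness the
    entries of [s] gives one [t] serving for all of them. *)
Lemma t_closure_common I s : submodule I -> nonzero I ->
  [set` s] `<=` t_closure I ->
  exists t, [/\ [set` t] `<=` I, nonzero [set` t]
              & [set` s] `<=` v_closure [set` t]].
Proof.
move=> Im [z Iz z0]; elim: s => [_|x s IH sI].
  exists [:: z]; split=> //; first by move=> y; rewrite /= inE => /eqP ->.
  by exists z; rewrite //= mem_head.
have [|t [tI [w tw w0] st]] := IH.
  by move=> y ys; apply: sI; rewrite /= inE ys orbT.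
have /t_closureP-/(_ Im)[t' [t'I _ xt']] : t_closure I x.
  by apply: sI; rewrite /= mem_head.
exists (t ++ t'); split.
- by move=> y; rewrite /= mem_cat => /orP[/tI|/t'I].
- by exists w; rewrite //= mem_cat tw.
- move=> y; rewrite /= inE => /orP[/eqP ->|/st ys].
    by apply: v_closureS xt' => u ut; rewrite /= mem_cat ut orbT.
  by apply: v_closureS ys => u ut; rewrite /= mem_cat ut.
Qed.

Lemma submodule_t_closure I : submodule I -> nonzero I ->
  submodule (t_closure I).
Proof.
(* The t-closure absorbs the v-closures of its finite subsets; these are submodules, so sums and
   multiples can be formed inside them. *)
move=> Im I0; have vcl s : [set` s] `<=` t_closure I ->
    v_closure [set` s] `<=` t_closure I.
  move=> /(t_closure_common Im I0)[t [tI t0 st]] y sy.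
  by apply/t_closureP => //; exists t; split=> //; exact: v_closure_sub sy.
split.
- by apply: sub_t_closure => //; case: Im.
- move=> x y Ix Iy; apply: (vcl [:: x; y]).
    by move=> z; rewrite /= !inE => /orP[] /eqP ->.
  by case: (submodule_inv (ideal_inv [set` [:: x; y]])) => _ D _; apply: D;
     apply: sub_v_closure; rewrite /= !inE eqxx ?orbT.
- move=> a x Ix; apply: (vcl [:: x]).
    by move=> z; rewrite /= !inE => /eqP ->.
  by case: (submodule_inv (ideal_inv [set` [:: x]])) => _ _ D; apply: D;
     apply: sub_v_closure; rewrite /= !inE eqxx ?orbT.
Qed.

Lemma ideal_mulS I I' J : I `<=` I' -> ideal_mul I J `<=` ideal_mul I' J.
Proof.
by move=> II' z [n [x [y [xI yJ zE]]]]; exists n, x, y; split=> // i; exact: II'.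
Qed.

(** Finitely many sums of products involve only finitely many elements of the union, and by
    monotonicity a single [F n] contains them. *)
Lemma ideal_mul_bigcup (F : nat -> set {fraction A}) J s :
  (forall m n, (m <= n)%N -> F m `<=` F n) ->
  [set` s] `<=` ideal_mul (\bigcup_n F n) J ->
  exists n, [set` s] `<=` ideal_mul (F n) J.
Proof.
move=> Fmono; elim: s => [_|z s IH sF]; first by exists 0%N.
have [|n sn] := IH; first by move=> u us; apply: sF; rewrite /= inE us orbT.
have [|k [x [y [xF yJ zE]]]] := sF z; first by rewrite /= mem_head.
have /choice[f fP] : forall i, exists n, F n (x i).
  by move=> i; have [m _] := xF i; exists m.
exists (maxn n (\max_(i < k) f i)) => u; rewrite /= inE => /orP[/eqP ->|us].
  exists k, x, y; split=> // i; apply: Fmono (fP i).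
  by rewrite leq_max (leq_bigmax i) orbT.
by apply: ideal_mulS (sn _ us); apply: Fmono; exact: leq_maxl.
Qed.

Lemma t_ideal_t_closure I : submodule I -> nonzero I -> t_ideal (t_closure I).
Proof.
move=> Im I0; rewrite /t_ideal eqEsubset; split; last first.
  apply: sub_t_closure; first exact: submodule_t_closure.
  by case: (I0) => z Iz z0; exists z => //; exact: sub_t_closure.
move=> y /t_closureP-/(_ (submodule_t_closure Im I0))[s [sI _ vy]].
have [t [tI t0 st]] := t_closure_common Im I0 sI.
by apply/t_closureP => //; exists t; split=> //; exact: v_closure_sub vy.
Qed.

Lemma t_closure_integers I : integral_ideal I -> t_closure I `<=` integers A.
Proof.
move=> [Im IA] y /t_closureP-/(_ Im)[s [sI _ vy]].
rewrite -[y]mulr1; by apply: vy => x /sI /IA; rewrite mul1r.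
Qed.

Lemma t_idealP I s y : submodule I -> t_ideal I ->
  [set` s] `<=` I -> nonzero [set` s] -> v_closure [set` s] y -> I y.
Proof.
by move=> Im It sI s0 vy; rewrite -It; apply/t_closureP => //; exists s.
Qed.

Lemma integral_ideal_eq1 I : integral_ideal I -> I 1 -> I = integers A.
Proof.
move=> [[_ _ Is] IA] I1; rewrite eqEsubset; split=> // _ [a _ <-].
by rewrite -[_%:F]mulr1; exact: Is.
Qed.
End Closures.

(** * t-maximal ideals *)

Section TMax.
Variable A : idomainType.
Implicit Types (I M : set {fraction A}) (s t : seq A).

Lemma proper_t_ideal_not1 I : proper_t_ideal I -> ~ I 1.
Proof. by move=> [Ii _ _ IA] /(integral_ideal_eq1 Ii). Qed.

(** The t-operation has finite type: a finite sequence in the union of a chain lies in one member,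
    which then contains its v-closure. *)
Lemma proper_t_ideal_bigcup (F : set (set {fraction A})) : F !=set0 ->
  F `<=` @proper_t_ideal A -> total_on F subset ->
  proper_t_ideal (\bigcup_(X in F) X).
Proof.
move=> [S0 FS0] Fp Ftot; set U := \bigcup_(X in F) X.
have [[[z0 _ _] _] [w0 Sw0 wn0] _ _] := Fp _ FS0.
have Um : submodule U.
  split; first by exists S0.
    move=> x y [S FS Sx] [T FT Ty].
    have [ST|TS] := Ftot _ _ FS FT.
      have [[[_ D _] _] _ _ _] := Fp _ FT.
      by exists T => //; apply: D => //; exact: ST.
    have [[[_ D _] _] _ _ _] := Fp _ FS.
    by exists S => //; apply: D => //; exact: TS.
  move=> a x [S FS Sx]; exists S => //.
  by have [[[_ _ Z] _] _ _ _] := Fp _ FS; exact: Z.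
have Ui : integral_ideal U.
  by split=> // x [S FS Sx]; have [[_ SA] _ _ _] := Fp _ FS; exact: SA.
have U0 : nonzero U by exists w0 => //; exists S0.
split=> //.
- rewrite /t_ideal eqEsubset; split; last exact: sub_t_closure.
  move=> y /t_closureP-/(_ Um)[s [sU sn0 vy]].
  have [S FS sS] : exists2 S, F S & [set` s] `<=` S.
    elim: s {sn0 vy} sU => [_|x s IH sU]; first by exists S0.
    have [|S FS sS] := IH; first by move=> u us; apply: sU; rewrite /= inE us orbT.
    have [|T FT Tx] := sU x; first by rewrite /= mem_head.
    have [ST|TS] := Ftot _ _ FS FT.
      by exists T => // u; rewrite /= inE => /orP[/eqP ->//|/sS]; exact: ST.
    by exists S => // u; rewrite /= inE => /orP[/eqP ->|/sS//]; exact: TS.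
  have [[Sm _] _ St _] := Fp _ FS.
  by exists S => //; exact: (t_idealP Sm St sS).
- move=> UA; have [S FS] : U 1 by rewrite UA; exact: integers1.
  exact/proper_t_ideal_not1/Fp.
Qed.

Lemma exists_t_Max I : proper_t_ideal I -> exists2 M, t_Max A M & I `<=` M.
Proof.
move=> Ip.
(* The empty chain has empty union, so Zorn's lemma requires [set0] to satisfy [P]; it is not
   maximal because [I] lies above it. *)
pose P S := S = set0 \/ (I `<=` S /\ @proper_t_ideal A S).
have [F FP Ftot|M [MP Mmax]] := @Zorn_bigcup _ P.
  have [[S [FS [IS Sp]]]|noS] :=
    pselect (exists S, F S /\ I `<=` S /\ proper_t_ideal S); last first.
    left; rewrite -subset0 => x [S FS Sx].
    case: (FP _ FS) => [S0|h]; first by rewrite S0 in Sx.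
    by case: noS; exists S.
  right; split; first by move=> x /IS Sx; exists S.
  have -> : \bigcup_(X in F) X = \bigcup_(X in F `&` @proper_t_ideal A) X.
    rewrite eqEsubset; split=> x [T FT Tx]; last by exists T => //; case: FT.
    case: (FP _ FT) => [T0|[_ Tp]]; first by rewrite T0 in Tx.
    by exists T.
  apply: proper_t_ideal_bigcup; first by (exists S; split).
    by move=> T [].
  by move=> T T' [FT _] [FT' _]; exact: Ftot.
case: MP => [M0|[IM Mp]].
  case: (Mmax I); last by (right; split).
  by rewrite M0; split=> [x|h] //; case: Ip => _ [x /h] .
exists M => //; split=> // N Np MN; apply: contrapT => NM.
apply: (Mmax N); last by right; split=> //; exact: subset_trans MN.
by split=> // NM1; apply: NM; rewrite eqEsubset.
Qed.

(** By maximality the t-closure of M + pA contains 1; [t] collects the M-components of finitely many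
    elements witnessing this. The conclusion says that the inverse of (p, t) lies in A. *)
Lemma t_Max_comaximal M (p : A) : t_Max A M -> ~ M p%:F ->
  exists t, (forall a, a \in t -> M a%:F) /\
    forall y, integers A (y * p%:F) ->
      (forall a, a \in t -> integers A (y * a%:F)) -> integers A y.
Proof.
move=> [[[Mm MA] Mn0 Mt M1] Mmax] Mp; have [M0 MD MZ] := Mm.
pose I := [set x | exists m b, M m /\ x = m + b%:F * p%:F].
have MI : M `<=` I by move=> m Mm'; exists m, 0; rewrite tofrac0 mul0r addr0.
have Im : submodule I.
  split; first exact: MI.
    move=> _ _ [m [b [Mx ->]]] [m' [b' [Mx' ->]]].
    exists (m + m'), (b + b'); split; first exact: MD.
    by rewrite tofracD mulrDl addrACA.
  move=> a _ [m [b [Mx ->]]]; exists (a%:F * m), (a * b).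
  by split; [exact: MZ|rewrite tofracM mulrDr mulrA].
have Ii : integral_ideal I.
  split=> // _ [m [b [Mx ->]]]; apply: integersD; first exact: MA.
  by apply: integersM; exact: integers_tofrac.
have In0 : nonzero I by case: Mn0 => z Mz z0; exists z => //; exact: MI.
have [I1|I1] := pselect (t_closure I 1); last first.
  have It : I `<=` t_closure I by exact: sub_t_closure.
  case: Mp; rewrite -(Mmax (t_closure I)).
  - apply: It; exists 0, 1; split=> //.
    by rewrite add0r tofrac1 mul1r.
  - split.
    + by split; [exact: submodule_t_closure|exact: t_closure_integers].
    + by case: In0 => z Iz z0; exists z => //; exact: It.
    + exact: t_ideal_t_closure.
    + by move=> E; apply: I1; rewrite E; exact: integers1.
  - exact: subset_trans It.
case/(t_closureP _ Im): I1 => s [sI _ v1].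
(* Elements of the inverse of [s] lie in A because 1 is in the v-closure of [s]. *)
suff [t [tM tP]] : exists t, (forall a, a \in t -> M a%:F) /\
    forall y, integers A (y * p%:F) ->
      (forall a, a \in t -> integers A (y * a%:F)) -> ideal_inv [set` s] y.
  exists t; split=> // y yp yt; rewrite -[y]mul1r; apply: v1.
  exact: tP.
elim: s sI {v1} => [_|x s IH sI]; first by exists [::].
have [|t [tM tP]] := IH; first by move=> u us; apply: sI; rewrite /= inE us orbT.
have [|m [b [Mm' xE]]] := sI x; first by rewrite /= mem_head.
have [a _ aE] := MA _ Mm'.
exists (a :: t); split.
  by move=> c; rewrite inE => /orP[/eqP ->|/tM//]; rewrite aE.
move=> y yp yt u; rewrite /= inE => /orP[/eqP ->|us]; last first.
  by apply: tP us => // c ct; apply: yt; rewrite inE ct orbT.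
rewrite xE mulrDr; apply: integersD.
  by rewrite -aE; apply: yt; rewrite mem_head.
by rewrite mulrCA; apply: integersM => //; exact: integers_tofrac.
Qed.

(** The last hypothesis places [b] in the v-closure of [s], and a t-ideal containing [s] contains
    that closure. *)
Lemma t_Max_v M s b : t_Max A M -> (exists2 a, a \in s & a != 0) ->
  (forall a, a \in s -> M a%:F) ->
  (forall y, (forall a, a \in s -> integers A (y * a%:F)) ->
     integers A (y * b%:F)) -> M b%:F.
Proof.
move=> [[[Mm MA] _ Mt _] _] [a sa a0] sM sb.
apply: (@t_idealP _ M (map (@FracField.tofrac A) s)) => //.
- by move=> _ /mapP[c cs ->]; exact: sM.
- by exists a%:F; [exact: map_f|rewrite tofrac_eq0].
- move=> y hy; rewrite mulrC; apply: sb => c cs.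
  by apply: hy; exact: map_f.
Qed.

(** Primality follows from comaximality: as (a, t) has v-closure A, [b] is in the v-closure of (ab,
    bt), a sequence that would lie in M. *)
Lemma t_MaxM M a b : t_Max A M -> ~ M a%:F -> ~ M b%:F -> ~ M (a * b)%:F.
Proof.
move=> Mmax Ma Mb Mab; apply: (Mb).
have [t [tM tP]] := t_Max_comaximal Mmax Ma.
have [[[[M0 _ Mz] _] _ _ _] _] := Mmax.
apply: (@t_Max_v M (a * b :: [seq b * c | c <- t])) => //.
- exists (a * b); first by rewrite mem_head.
  rewrite mulf_neq0 //.
    by apply/eqP => a0; apply: Ma; rewrite a0 tofrac0.
  by apply/eqP => b0; apply: Mb; rewrite b0 tofrac0.
- move=> c; rewrite inE => /orP[/eqP ->//|/mapP[d dt ->]].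
  by rewrite tofracM; apply: Mz; exact: tM.
- move=> y hy; apply: tP.
    by rewrite -mulrA -tofracM [b * a]mulrC; apply: hy; rewrite mem_head.
  move=> c ct; rewrite -mulrA -tofracM; apply: hy.
  by rewrite inE map_f ?orbT.
Qed.

Lemma t_Max_notin M a : t_Max A M -> ~ M a%:F -> a%:F != 0 :> {fraction A}.
Proof.
move=> [[[[M0 _ _] _] _ _ _] _] Ma.
by apply/eqP => a0; apply: Ma; rewrite a0.
Qed.

(** The denominators of [y] in A form the inverse [D] of (1, y), a t-ideal. If [y] is not in A, then
    [D] is proper and some t-maximal ideal contains it, against the denominator [c] outside that
    ideal. *)
Lemma integers_t_local y :
  (forall M, t_Max A M -> exists c : A, ~ M c%:F /\ integers A (c%:F * y)) ->
  integers A y.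
Proof.
move=> yloc; apply: contrapT => yA.
pose D := ideal_inv [set` [:: 1; y]].
have DP x : D x <-> integers A x /\ integers A (x * y).
  split=> [Dx|[xA xyA] z].
    by split; [rewrite -[x]mulr1|]; apply: Dx; rewrite /= !inE eqxx ?orbT.
  by rewrite /= !inE => /orP[] /eqP ->; rewrite ?mulr1.
have Dm : submodule D := submodule_inv _.
have Dn0 : nonzero D.
  have [a [c [c0 yE]]] := fractionP y.
  exists c%:F; last by rewrite tofrac_eq0.
  apply/DP; split; first exact: integers_tofrac.
  by rewrite yE mulrC divfK ?tofrac_eq0 //; exact: integers_tofrac.
have [|M Mmax DM] := @exists_t_Max D.
  split=> //.
  - by split=> // x /DP[].
  - rewrite /t_ideal eqEsubset; split; last exact: sub_t_closure.
    move=> x /t_closureP-/(_ Dm)[s [sD _ vx]] z Sz.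
    by apply: vx => u /sD; rewrite mulrC; exact.
  - by move=> D1; move: (@integers1 A); rewrite -D1 => /DP[_]; rewrite mul1r.
have [c [Mc cy]] := yloc _ Mmax.
by apply: Mc; apply: DM; apply/DP; split=> //; exact: integers_tofrac.
Qed.
End TMax.

(** * Localization at a t-maximal ideal *)

Section Localization.
Variables (A : idomainType) (M : set {fraction A}).
Hypothesis Mmax : t_Max A M.
Local Notation B := (localization M).

Lemma localizationP x :
  B x <-> exists c : A, ~ M c%:F /\ integers A (c%:F * x).
Proof.
split=> [[a [c [Mc ->]]]|[c [Mc [a _ aE]]]].
  by exists c; rewrite mulrC divfK ?(t_Max_notin Mmax) //; split=> //; exists a.
by exists a, c; split=> //; rewrite aE mulrC mulKf ?(t_Max_notin Mmax).
Qed.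

Lemma integers_localization x : integers A x -> B x.
Proof.
move=> xA; apply/localizationP; exists 1; split; last by rewrite tofrac1 mul1r.
by rewrite tofrac1; apply: proper_t_ideal_not1; case: Mmax.
Qed.

Lemma localizationM x y : B x -> B y -> B (x * y).
Proof.
move=> /localizationP[c [Mc cx]] /localizationP[d [Md dy]].
apply/localizationP; exists (c * d); split; first exact: t_MaxM.
by rewrite tofracM mulrACA; exact: integersM.
Qed.

Lemma common_denominator (J : set {fraction A}) (s : seq {fraction A}) :
  submodule J ->
  (forall x, x \in s -> exists c : A, ~ M c%:F /\ J (c%:F * x)) ->
  exists c : A, ~ M c%:F /\ forall x, x \in s -> J (c%:F * x).
Proof.
move=> [_ _ JZ]; elim: s => [_|x s IH h].
  exists 1; split=> //; rewrite tofrac1.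
  by apply: proper_t_ideal_not1; case: Mmax.
have [|c [Mc cs]] := IH; first by move=> y ys; apply: h; rewrite inE ys orbT.
have [|d [Md dx]] := h x; first by rewrite mem_head.
exists (c * d); split; first exact: t_MaxM.
move=> y; rewrite inE => /orP[/eqP ->|/cs ys]; rewrite tofracM.
  by rewrite -mulrA; exact: JZ.
by rewrite [c%:F * _]mulrC -mulrA; exact: JZ.
Qed.

(** A finite sum has a common denominator outside M; conversely [z] is the single product of c z and
    1 / c. *)
Lemma ideal_mul_localization (J : set {fraction A}) z : submodule J ->
  ideal_mul J B z <-> exists c : A, ~ M c%:F /\ J (c%:F * z).
Proof.
move=> Jm; have [_ _ JZ] := Jm; split.
  move=> [n [x [y [Jx By ->]]]].
  have [c [Mc cx]] : exists c : A, ~ M c%:F /\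
      forall u, u \in [seq x i * y i | i <- enum 'I_n] -> J (c%:F * u).
    apply: common_denominator => // _ /mapP[i _ ->].
    have /localizationP[c [Mc [a _ aE]]] := By i.
    by exists c; split=> //; rewrite mulrCA -aE mulrC; exact: JZ.
  exists c; split=> //; rewrite mulr_sumr; apply: submodule_sum => // i.
  by apply: cx; apply: map_f; rewrite mem_enum.
move=> [c [Mc cz]]; exists 1%N, (fun=> c%:F * z), (fun=> c%:F^-1); split=> //.
  move=> _; apply/localizationP; exists c; split=> //.
  by rewrite divff ?(t_Max_notin Mmax) //; exact: integers1.
by rewrite big_ord1 mulrC mulKf ?(t_Max_notin Mmax).
Qed.

Lemma dvd_in_trans x y z : dvd_in B x y -> dvd_in B y z -> dvd_in B x z.
Proof.
move=> [u Bu ->] [v Bv ->]; exists (u * v); last by rewrite mulrA.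
exact: localizationM.
Qed.

Hypothesis Bgcd : GCD_domain B.

Lemma GCD_domain_seq (s : seq {fraction A}) : [set` s] `<=` B ->
  exists d, [/\ B d, forall x, x \in s -> dvd_in B d x
    & forall e, B e -> (forall x, x \in s -> dvd_in B e x) -> dvd_in B e d].
Proof.
have B0 : B 0 by apply: integers_localization; exact: integers0.
have B1 : B 1 by apply: integers_localization; exact: integers1.
elim: s => [_|x s IH sB].
  (* Everything divides 0, so 0 is the gcd of the empty sequence. *)
  by exists 0; split=> // e _ _; exists 0 => //; rewrite mulr0.
have [|d [Bd ds dmax]] := IH.
  by move=> u us; apply: sB; rewrite /= inE us orbT.
have Bx : B x by apply: sB; rewrite /= mem_head.
suff [d' [Bd' d'x d'd d'max]] : exists d', [/\ B d', dvd_in B d' x,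
    dvd_in B d' d & forall e, B e -> dvd_in B e x -> dvd_in B e d ->
    dvd_in B e d'].
  exists d'; split=> //.
    move=> y; rewrite inE => /orP[/eqP -> //|/ds].
    exact: dvd_in_trans.
  move=> e Be h; apply: d'max => //; first by apply: h; rewrite mem_head.
  by apply: dmax => // y ys; apply: h; rewrite inE ys orbT.
(* [GCD_domain] speaks of nonzero pairs only; when one entry is 0, the other is the gcd. *)
have [->|x0] := eqVneq x 0.
  exists d; split=> //; first by exists 0; rewrite ?mulr0.
  by exists 1; rewrite ?mulr1.
have [->|d0] := eqVneq d 0; last exact: Bgcd.
exists x; split=> //; first by exists 1; rewrite ?mulr1.
by exists 0; rewrite ?mulr0.
Qed.

(** With w = u / v, the gcd [h] of the multiples u x is divisible by [u] and by [v]. Writing h = u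
    h' = v h'' gives w h' = h'', while h' divides [d], so w d is a multiple of h''. *)
Lemma GCD_domain_colon (s : seq {fraction A}) : [set` s] `<=` B ->
  exists d, [/\ B d, forall x, x \in s -> dvd_in B d x
    & forall w, (forall x, x \in s -> B (w * x)) -> B (w * d)].
Proof.
move=> sB; have [d [Bd ds dmax]] := GCD_domain_seq sB.
exists d; split=> // w ws.
have [->|w0] := eqVneq w 0.
  by rewrite mul0r; apply: integers_localization; exact: integers0.
have [u [v [v0 wE]]] := fractionP w.
have v0' : v%:F != 0 :> {fraction A} by rewrite tofrac_eq0.
have u0 : u%:F != 0 :> {fraction A}.
  by apply: contraNneq w0 => u0; rewrite wE u0 mul0r.
have Bint (a : A) : B a%:F.
  by apply: integers_localization; exact: integers_tofrac.
have uE : u%:F = w * v%:F by rewrite wE divfK.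
have [|h [Bh hs hmax]] := @GCD_domain_seq [seq u%:F * x | x <- s].
  by move=> _ /mapP[x xs ->]; apply: localizationM => //; exact: sB.
have [h' Bh' hE] : dvd_in B u%:F h.
  by apply: hmax => // _ /mapP[x xs ->]; exists x => //; exact: sB.
have [h'' Bh'' hE'] : dvd_in B v%:F h.
  apply: hmax => // _ /mapP[x xs ->]; exists (w * x); first exact: ws.
  by rewrite uE mulrAC mulrC.
have [z Bz ->] : dvd_in B h' d.
  apply: dmax => // x xs; have [|z Bz uxE] := hs (u%:F * x).
    exact: map_f.
  by exists z => //; apply: (mulfI u0); rewrite uxE hE mulrA.
rewrite mulrA; apply: localizationM => //.
suff -> : w * h' = h'' by [].
by apply: (mulfI v0'); rewrite -hE' hE uE mulrA [v%:F * w]mulrC.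
Qed.

End Localization.

(** * The colon ideals (aA : P) for P finitely generated *)

Section Colon.
Variable A : idomainType.
Implicit Types (a : A) (P Q : seq A).

(** For [a] nonzero this is [a] times the inverse of the ideal generated by [P], taken in K; that it
    lies in A is proved separately along the chain. *)
Definition colon a P : set {fraction A} :=
  [set z | forall p, p \in P -> integers A (z * p%:F / a%:F)].

Lemma submodule_colon a P : submodule (colon a P).
Proof.
split=> [p _|x y hx hy p pP|b x hx p pP].
- by rewrite !mul0r; exact: integers0.
- by rewrite !mulrDl; apply: integersD; [exact: hx|exact: hy].
- rewrite -2!mulrA; apply: integersM; first exact: integers_tofrac.
  by rewrite mulrA; exact: hx.
Qed.

(** The generator is a / d with [d] the gcd of [P] in the localization. One direction is
    [GCD_domain_colon] at z / a; the other holds because [d] divides each entry of [P]. *)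
Lemma colon_t_locally_principal a P M : t_Max A M -> GCD_domain (localization M) ->
  a != 0 -> (exists2 p, p \in P & p != 0) ->
  exists2 g, g != 0 & forall z,
    (exists c : A, ~ M c%:F /\ colon a P (c%:F * z)) <->
    localization M (z / g).
Proof.
move=> Mmax Bgcd a0 [q qP q0].
have a0' : a%:F != 0 :> {fraction A} by rewrite tofrac_eq0.
have [|d [Bd dP dcolon]] :=
    @GCD_domain_colon _ _ Mmax Bgcd (map (@FracField.tofrac A) P).
  move=> _ /mapP[p _ ->]; apply: integers_localization => //.
  exact: integers_tofrac.
have d0 : d != 0.
  have [|b _ qE] := dP q%:F; first exact: map_f.
  by move: q0; apply: contra_neq => d0; apply/eqP; rewrite -tofrac_eq0 qE d0 mul0r.
exists (a%:F / d); first by rewrite mulf_neq0 ?invr_neq0.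
move=> z; rewrite invf_div mulrCA mulrC; split.
  move=> [c [Mc h]]; apply: dcolon => _ /mapP[p pP ->].
  apply/localizationP => //; exists c; split=> //.
  by rewrite mulrAC !mulrA; exact: h.
move=> Bz; have [|c [Mc h]] := @common_denominator _ _ Mmax (integers A)
    [seq z / a%:F * p%:F | p <- P] (submodule_integers A).
  move=> _ /mapP[p pP ->]; apply/localizationP => //.
  have [|b Bb ->] := dP p%:F; first exact: map_f.
  by rewrite mulrA; exact: localizationM.
exists c; split=> // p pP.
suff -> : c%:F * z * p%:F / a%:F = c%:F * (z / a%:F * p%:F).
  by apply: h; exact: (map_f (fun p => z / a%:F * p%:F)).
by rewrite mulrAC -!mulrA.
Qed.

Definition seq_mul P Q : seq A := [seq p * q | p <- P, q <- Q].

Lemma colon_seq_mulP a P Q z :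
  colon a (seq_mul P Q) z <-> forall q, q \in Q -> colon a P (z * q%:F).
Proof.
split=> [h q qQ p pP|h _ /allpairsP[[p q] [/= pP qQ ->]]].
  by rewrite -[z * _ * _]mulrA -tofracM [q * p]mulrC; apply: h; exact: allpairs_f.
by rewrite [p * q]mulrC tofracM mulrA; exact: h.
Qed.

Lemma colon_seq_mul_sub a P Q : colon a P `<=` colon a (seq_mul P Q).
Proof.
move=> z hz; apply/colon_seq_mulP => q _; rewrite mulrC.
by have [_ _ Z] := submodule_colon a P; exact: Z.
Qed.

(* A finite sequence stands for the ideal it generates. *)
Definition contained P (M : set {fraction A}) := forall p, p \in P -> M p%:F.

Lemma not_containedP P M : ~ contained P M -> exists2 p, p \in P & ~ M p%:F.
Proof.
move=> PM; apply: contrapT => h; apply: PM => p pP.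
by apply: contrapT => Mp; apply: h; exists p.
Qed.

Lemma contained_seq_mul P Q M : t_Max A M ->
  contained (seq_mul P Q) M <-> contained P M \/ contained Q M.
Proof.
move=> Mmax; have [[[[_ _ MZ] _] _ _ _] _] := Mmax.
split=> [PQM|[PM|QM] _ /allpairsP[[p q] [/= pP qQ ->]]].
- have [PM|/not_containedP[p pP Mp]] := pselect (contained P M); first by left.
  right=> q qQ; apply: contrapT => Mq; apply: (t_MaxM Mmax Mp Mq).
  by apply: PQM; exact: allpairs_f.
- by rewrite mulrC tofracM; apply: MZ; exact: PM.
- by rewrite tofracM; apply: MZ; exact: QM.
Qed.

(** [Q] completes [p] to a sequence with v-closure A, so a t-maximal ideal containing both would
    contain 1. *)
Lemma t_Max_avoid M p : t_Max A M -> ~ M p%:F ->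
  exists2 Q, contained Q M & forall N, t_Max A N -> contained Q N -> ~ N p%:F.
Proof.
move=> Mmax Mp; have [Q [QM Qp]] := t_Max_comaximal Mmax Mp.
exists Q => // N Nmax QN Np; have [/proper_t_ideal_not1 N1 _] := Nmax.
apply: N1; rewrite -(tofrac1 A); apply: (@t_Max_v _ N (p :: Q)) => //.
- exists p; first by rewrite mem_head.
  by rewrite -tofrac_eq0; exact: t_Max_notin Mp.
- by move=> q; rewrite inE => /orP[/eqP ->//|]; exact: QN.
- move=> y hy; rewrite tofrac1 mulr1; apply: Qp.
    by apply: hy; rewrite mem_head.
  by move=> q qQ; apply: hy; rewrite inE qQ orbT.
Qed.

(** * Splitting off a t-comaximal factor *)

Definition t_Max_outside a P : set (set {fraction A}) :=
  [set M | [/\ t_Max A M, M a%:F & ~ contained P M]].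

Lemma t_comaximal_split a P : infinite_set (t_Max_outside a P) ->
  exists Q, [/\ a \in Q, exists2 M, t_Max A M & contained Q M,
    forall M, t_Max A M -> contained Q M -> ~ contained P M
  & infinite_set (t_Max_outside a (seq_mul P Q))].
Proof.
move=> Xinf.
have [M1 [M1max M1a /not_containedP[p1 p1P M1p1]]] := infinite_setN0 Xinf.
have [M2 [[M2max M2a /not_containedP[p2 p2P M2p2]] M12]] :
    (t_Max_outside a P `\ M1) !=set0.
  by apply: infinite_setN0; apply: infinite_setD => //; exact: finite_set1.
(* If no such [q] existed, M2 would be included in M1 and hence equal to it. *)
have [q M2q M1q] : exists2 q : A, M2 q%:F & ~ M1 q%:F.
  apply: contrapT => h; apply: M12; apply/esym.
  have [M1p _] := M1max; have [[[_ M2A] _ _ _] M2m] := M2max.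
  rewrite /= (M2m M1) // => x M2x; have [b _ bE] := M2A _ M2x.
  by rewrite -bE; apply: contrapT => M1b; apply: h; exists b; rewrite // bE.
have [Q1 Q1M1 Q1p1] := t_Max_avoid M1max M1p1.
have [Q1' Q1'M1 Q1'q] := t_Max_avoid M1max M1q.
have [Q2 Q2M2 Q2p2] := t_Max_avoid M2max M2p2.
(* [Q1] and [Q2] keep [F1] and [F2] apart from [P], through [p1] and [p2]; [Q1'] keeps [F1] apart
   from [F2], which contains [q]. *)
pose F1 := a :: Q1 ++ Q1'; pose F2 := a :: q :: Q2.
have [finF1|infF1] := pselect (finite_set (t_Max_outside a (seq_mul P F1))).
  have [finF2|infF2] := pselect (finite_set (t_Max_outside a (seq_mul P F2))).
    (* No t-maximal ideal contains both [F1] and [F2], so the two finite sets would cover all the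
       ideals outside [P]. *)
    case: Xinf; apply: (@sub_finite_set _ _
      (t_Max_outside a (seq_mul P F1) `|` t_Max_outside a (seq_mul P F2))).
      move=> M [Mmax Ma PM]; apply: contrapT => h.
      have [F1M F2M] : contained F1 M /\ contained F2 M.
        split; apply: contrapT => FM; apply: h; [left|right];
        by split=> // /(contained_seq_mul _ _ Mmax)[].
      apply: (Q1'q M Mmax).
        by move=> x xQ; apply: F1M; rewrite inE mem_cat xQ !orbT.
      by apply: F2M; rewrite !inE eqxx orbT.
    by rewrite finite_setU.
  exists F2; split=> //; first by rewrite mem_head.
    by exists M2 => // x; rewrite !inE => /or3P[/eqP ->|/eqP ->|/Q2M2].
  move=> M Mmax F2M PM; apply: (Q2p2 M Mmax); last exact: PM.
  by move=> x xQ; apply: F2M; rewrite !inE xQ !orbT.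
exists F1; split=> //; first by rewrite mem_head.
  by exists M1 => // x; rewrite inE mem_cat => /or3P[/eqP ->|/Q1M1|/Q1'M1].
move=> M Mmax F1M PM; apply: (Q1p1 M Mmax); last exact: PM.
by move=> x xQ; apply: F1M; rewrite inE mem_cat xQ !orbT.
Qed.

(** Integrality is checked locally. If M misses some q in [Q], then z q is in (aA : P), so in A.
    Otherwise M misses some p in [P], and a in [Q] gives z a p / a = z p in A. *)
Lemma colon_seq_mul_integers a P Q : a != 0 -> a \in Q ->
  (forall M, t_Max A M -> contained Q M -> ~ contained P M) ->
  colon a P `<=` integers A -> colon a (seq_mul P Q) `<=` integers A.
Proof.
move=> a0 aQ PQ PA z zPQ; apply: integers_t_local => M Mmax.
have zQ q : q \in Q -> integers A (q%:F * z).
  by move=> qQ; rewrite mulrC; apply: PA; move/colon_seq_mulP : zPQ; exact.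
have zP p : p \in P -> integers A (p%:F * z).
  move=> pP; move/colon_seq_mulP : zPQ => /(_ _ aQ _ pP).
  by rewrite mulrAC mulfK ?tofrac_eq0 // mulrC.
have [QM|/not_containedP[q qQ Mq]] := pselect (contained Q M).
  have /not_containedP[p pP Mp] := PQ _ Mmax QM.
  by exists p; split=> //; exact: zP.
by exists q; split=> //; exact: zQ.
Qed.

(** Inclusion would force the inverse of [Q] into A: for y in it, a y is in (aA : PQ), hence y p is
    in A for p in [P], and each t-maximal ideal misses an entry of [P] or of [Q]. Then 1 is in the
    v-closure of [Q], so in M. *)
Lemma colon_seq_mul_strict a P Q : a != 0 -> a \in Q ->
  (forall M, t_Max A M -> contained Q M -> ~ contained P M) ->
  (exists2 M, t_Max A M & contained Q M) ->
  ~ (colon a (seq_mul P Q) `<=` colon a P).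
Proof.
move=> a0 aQ PQ [M Mmax QM] sub; have [/proper_t_ideal_not1 M1 _] := Mmax.
have a0' : a%:F != 0 :> {fraction A} by rewrite tofrac_eq0.
apply: M1; rewrite -(tofrac1 A); apply: (@t_Max_v _ M Q) => //.
  by exists a.
move=> y yQ; rewrite tofrac1 mulr1; apply: integers_t_local => N Nmax.
have yP : colon a P (a%:F * y).
  apply: sub; apply/colon_seq_mulP => q qQ p pP.
  rewrite -!mulrA mulrC !mulrA divfK //.
  by apply: integersM; [exact: yQ|exact: integers_tofrac].
have [QN|/not_containedP[q qQ Nq]] := pselect (contained Q N).
  have /not_containedP[p pP Np] := PQ _ Nmax QN.
  exists p; split=> //; have := yP _ pP.
  by rewrite -!mulrA mulrC !mulrA divfK // [y * _]mulrC.
by exists q; split=> //; rewrite mulrC; exact: yQ.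
Qed.

End Colon.

(** * The chain of colon ideals and its union *)

Theorem proposition2p6 (A : idomainType) (hA : t_locally_GCD A)
    (hinv : forall I : set {fraction A},
       integral_ideal I -> nonzero I -> t_locally_principal I ->
       t_invertible I) :
  t_finite_character A.
Proof.
move=> a a0; apply: contrapT => Xinf.
have a0' : a%:F != 0 :> {fraction A} by rewrite tofrac_eq0.
(* [Q] has to be total, so its properties are conditional; [Pinf] shows that the condition holds at
   every [P n]. *)
have /choice[Q QP] : forall P, exists F,
    infinite_set (t_Max_outside a P) ->
    [/\ a \in F, exists2 M, t_Max A M & contained F M,
      forall M, t_Max A M -> contained F M -> ~ contained P M
    & infinite_set (t_Max_outside a (seq_mul P F))].
  move=> P.
  have [/t_comaximal_split[F FP]|fin] := pselect (infinite_set (t_Max_outside a P)).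
    by exists F.
  by exists [::] => /fin.
(* The start [[:: 1]] generates A, so [J 0] is aA and every t-maximal ideal above [a] is still
   available. *)
pose P n := iter n (fun s => seq_mul s (Q s)) [:: 1].
have PS n : P n.+1 = seq_mul (P n) (Q (P n)) by [].
have Pinf n : infinite_set (t_Max_outside a (P n)).
  elim: n => [|n /QP[] //]; apply: sub_infinite_set Xinf => M [Mmax Ma].
  split=> // /(_ 1); rewrite mem_head tofrac1 => /(_ isT).
  by apply: proper_t_ideal_not1; case: Mmax.
have Pn0 n : exists2 p, p \in P n & p != 0.
  elim: n => [|n [p pP p0]]; first by exists 1; rewrite ?mem_head ?oner_eq0.
  have [aQ _ _ _] := QP _ (Pinf n).
  by exists (p * a); [exact: allpairs_f|rewrite mulf_neq0].
pose J n := colon a (P n).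
have JS n : J n `<=` J n.+1 by exact: colon_seq_mul_sub.
have Jmono m n : (m <= n)%N -> J m `<=` J n.
  move=> /subnK <-; elim: (n - m)%N => // k IH.
  by apply: subset_trans IH _; exact: JS.
have JA n : J n `<=` integers A.
  elim: n => [z /(_ 1)|n IH]; last first.
    have [aQ _ QPn _] := QP _ (Pinf n).
    by rewrite /J PS; exact: colon_seq_mul_integers.
  rewrite mem_head tofrac1 mulr1 => /(_ isT) zA.
  rewrite -[z](divfK a0'); apply: integersM => //; exact: integers_tofrac.
pose I := \bigcup_n J n.
have Im : submodule I.
  split; first by exists 0%N => //; case: (submodule_colon a (P 0)).
    move=> x y [m _ Jx] [n _ Jy]; exists (maxn m n) => //.
    have [_ D _] := submodule_colon a (P (maxn m n)); apply: D.
      by apply: Jmono Jx; exact: leq_maxl.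
    by apply: Jmono Jy; exact: leq_maxr.
  move=> b x [n _ Jx]; exists n => //.
  by have [_ _ Z] := submodule_colon a (P n); exact: Z.
have Ii : integral_ideal I by split=> // x [n _]; exact: JA.
have In0 : nonzero I.
  exists a%:F => //; exists 0%N => // p _; rewrite mulrAC divff // mul1r.
  exact: integers_tofrac.
have Iloc : t_locally_principal I.
  move=> M Mmax; have [[[[_ _ MZ] _] _ _ _] _] := Mmax.
  (* If [Q (P N)] lies in M, so does every later [P n], which keeps [Q (P n)] out of M; hence M is
     above at most one of them. *)
  have [N NP] : exists N, forall n, (N <= n)%N -> ~ contained (Q (P n)) M.
    apply: contrapT => h.
    have [N QM] : exists N, contained (Q (P N)) M.
      by apply: contrapT => h'; apply: h; exists 0%N => n _ ?; apply: h'; exists n.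
    apply: h; exists N.+1 => n Nn; have [_ _ QPn _] := QP _ (Pinf n).
    move=> /(QPn _ Mmax); apply; move: Nn => /subnK <-.
    elim: (n - N.+1)%N => [|k IH].
      by rewrite add0n PS; apply/contained_seq_mul => //; right.
    by rewrite addSn PS; apply/contained_seq_mul => //; left.
  (* The chain is stationary at M from [N] on: each step down from n + N absorbs into the
     denominator an entry of some [Q (P k)] outside M. *)
  have IE z : (exists c : A, ~ M c%:F /\ I (c%:F * z)) <->
              (exists c : A, ~ M c%:F /\ J N (c%:F * z)).
    split=> [[c [Mc [n _ Jn]]]|[c [Mc JN]]]; last by exists c; split=> //; exists N.
    have {Jn} : J (n + N)%N (c%:F * z) by apply: Jmono Jn; exact: leq_addr.
    elim: n c Mc => [|n IH] c Mc Jn; first by exists c.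
    have /NP/not_containedP[q qQ Mq] := leq_addl n N.
    apply: (IH (c * q)); first exact: t_MaxM.
    by rewrite tofracM mulrAC; move/colon_seq_mulP : Jn; exact.
  have [g g0 gP] := colon_t_locally_principal Mmax (hA _ Mmax) a0 (Pn0 N).
  have IBE z : ideal_mul I (localization M) z <-> localization M (z / g).
    rewrite -gP -IE; exact: ideal_mul_localization.
  exists g.
    (* The generator must lie in the localization: it belongs to the extension of [I], and [I] is
       inside A. *)
    have /(IBE g)/ideal_mul_localization : localization M (g / g).
      by rewrite divff //; apply: integers_localization => //; exact: integers1.
    move=> /(_ Mmax Im)[c [Mc [n _ /JA cg]]].
    by apply/localizationP => //; exists c.
  rewrite eqEsubset; split=> [z /IBE zg|_ [b Bb <-]].
    by exists (z / g) => //; rewrite mulrC divfK.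
  by apply/IBE; rewrite mulrC mulKf.
have : t_closure (ideal_mul I (ideal_inv I)) 1.
  by rewrite (hinv _ Ii In0 Iloc); exact: integers1.
move=> /t_closure_seq[s [sII _ v1]].
have [n sJ] := ideal_mul_bigcup Jmono sII.
have [aQ QM QPn _] := QP _ (Pinf n).
apply: (colon_seq_mul_strict a0 aQ QPn QM); rewrite -PS => z zJ p pP.
(* As 1 is in the v-closure of [s], z p / a is in A once its products with the entries of [s]
   are. *)
rewrite -[_ / _]mul1r; apply: v1 => u /sJ[m [x [y [xJ yI ->]]]].
rewrite mulr_sumr; apply: submodule_sum => [|i]; first exact: submodule_integers.
(* The regrouping is (x p / a)(y z): the first factor is integral since x is in [J n], the second
   since y is in the inverse of [I] and z is in [J n.+1], a part of [I]. *)
rewrite (AC (3*2) ((4*2*3)*(5*1))) /=; apply: integersM; first exact: xJ.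
by apply: yI; exists n.+1.
Qed.
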